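(* There is an infinite family of (pairwise non-isomorphic) cyclically $4$-edge-connected cubic graphs $G$ whose list normal chromatic index satisfies $\chi_{n,l}'(G) \ge 7$.
   Context: Graphs are finite and simple; a cubic graph is a $3$-regular graph. A connected graph is cyclically $4$-edge-connected if there is no set of fewer than $4$ edges whose removal leaves a graph with at least two connected components containing a cycle. A normal edge-coloring of a cubic graph $G$ is a proper edge-coloring such that, for every edge $e$, the set of colors appearing on the edges adjacent to $e$ has exactly four elements (then $e$ is called rich) or exactly two elements (then $e$ is called poor). A list assignment $L$ for $G$ assigns to each edge $e$ of $G$ a list (set) $L(e)$ of possible colors. The list normal chromatic index $\chi_{n,l}'(G)$ is the least $k$ such that, for every list assignment $L$ with $|L(e)|\ge k$ for every $e\in E(G)$, there is a normal edge-coloring $\varphi$ of $G$ with $\varphi(e)\in L(e)$ for every $e\in E(G)$. *)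

(* Defs.v *)
From HB Require Import structures.
From mathcomp Require Import all_boot.
From mathcomp Require Import finmap.

Set Implicit Arguments.
Unset Strict Implicit.
Unset Printing Implicit Defensive.

Record sgraph := SGraph {
  vertex :> finType;
  adj : rel vertex;
  adj_sym : symmetric adj;
  adj_irrefl : irreflexive adj
}.

Definition isomorphic (G H : sgraph) : Prop :=
  exists2 f : G -> H, bijective f & forall x y, adj (f x) (f y) = adj x y.

Definition cubic (G : sgraph) : Prop :=
  forall x : G, #|[set y | adj x y]| = 3.

(* An edge is the two-element set of its endpoints. *)
Definition edges (G : sgraph) : {set {set G}} :=
  [set [set p.1; p.2] | p in [set p : G * G | adj p.1 p.2]].

Section EdgeDeletion.
Variables (G : sgraph) (S : {set {set G}}).

Definition del_adj : rel G := fun x y => adj x y && ([set x; y] \notin S).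

Lemma del_adj_sym : symmetric del_adj.
Proof. by move=> x y; rewrite /del_adj adj_sym setUC. Qed.

Lemma del_adj_irrefl : irreflexive del_adj.
Proof. by move=> x; rewrite /del_adj adj_irrefl. Qed.

Definition del_edges : sgraph := SGraph del_adj_sym del_adj_irrefl.

End EdgeDeletion.

Definition connected (G : sgraph) : Prop :=
  0 < #|G| /\ forall x y : G, connect (@adj G) x y.

Definition components (G : sgraph) : {set {set G}} :=
  [set [set y | connect (@adj G) x y] | x in [set: G]].

(* [path.cycle] accepts closed walks of length 0 and 2; the size and
   uniqueness conditions leave exactly the graph-theoretic cycles. *)
Definition contains_cycle (G : sgraph) (A : {set G}) : Prop :=
  exists c : seq G,
    [/\ 2 < size c, uniq c, cycle (@adj G) c & {subset c <= A}].

Definition cyclically_4_edge_connected (G : sgraph) : Prop :=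
  connected G /\
  ~ exists S : {set {set G}},
      [/\ S \subset edges G, #|S| < 4 &
       exists A B : {set del_edges S},
         [/\ A \in components (del_edges S), B \in components (del_edges S),
             A != B, contains_cycle A & contains_cycle B]].

Definition adjacent_edges (G : sgraph) (e : {set G}) : {set {set G}} :=
  [set f in edges G | (f != e) && (f :&: e != set0)].

(* Colorings and list assignments are total functions on vertex sets; only
   their values on [edges G] are ever constrained. *)
Section NormalColoring.
Variables (G : sgraph) (C : choiceType) (phi : {set G} -> C).

Definition proper_edge_coloring : Prop :=
  forall e f, e \in edges G -> f \in adjacent_edges e -> phi e <> phi f.

Definition adjacent_colors (e : {set G}) : {fset C} :=
  [fset phi f | f in adjacent_edges e]%fset.

Definition rich (e : {set G}) : Prop := #|` adjacent_colors e| = 4.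
Definition poor (e : {set G}) : Prop := #|` adjacent_colors e| = 2.

Definition normal_edge_coloring : Prop :=
  proper_edge_coloring /\ forall e, e \in edges G -> rich e \/ poor e.

End NormalColoring.

Definition list_normal_colorable (G : sgraph) (k : nat) : Prop :=
  forall (C : choiceType) (L : {set G} -> {fset C}),
    (forall e, e \in edges G -> k <= #|` L e|) ->
    exists phi : {set G} -> C,
      normal_edge_coloring phi /\ forall e, e \in edges G -> phi e \in L e.

(* The index as the graph of a partial function: the least admissible k.
   For a cubic graph such a k exists, since giving all edges distinct
   colors makes every edge rich. *)
Definition list_normal_chromatic_index (G : sgraph) (k : nat) : Prop :=
  list_normal_colorable G k /\
  forall j, list_normal_colorable G j -> k <= j.

(* Main.v *)
Require Import Defs.
From mathcomp Require Import all_boot.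
From mathcomp Require Import finmap.
From mathcomp Require Import perm zify.
From Stdlib Require Import Classical_Prop.

Set Implicit Arguments.
Unset Strict Implicit.
Unset Printing Implicit Defensive.

(** The obstruction to six colours is a theta graph with seven edges: two
    branch vertices [p] and [q] joined by the paths [p u q], [p v q] and
    [p s t q].  Any two of its edges are adjacent or joined by a third one, so
    if all seven were rich they would need seven distinct colours.  In a cubic
    graph each of [u], [v], [s], [t] has one more edge, leaving the theta graph,
    and every edge of the theta graph is adjacent to one of these four.  A poor
    edge sees the same two colours at both of its ends; hence it suffices to
    give the seven edges one common list of six colours, and to the four outer
    edges lists that avoid these colours and are disjoint at [s] and [t]: no
    edge of the theta graph can then be poor, and six colours are too few
    ([theta_rainbow], [theta_not_6_choosable]).

    The infinite family is obtained from the prisms by crossing two consecutive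
    spokes, which creates such a theta graph ([crossed_prism]).  More generally,
    let two cycles of length at least four, the rims, be joined by a perfect
    matching of spokes.  Such a graph is cyclically 4-edge-connected.  Indeed,
    let two components left by an edge cut contain cycles.  If each contains
    both ends of some spoke, then both components meet both rims, and every rim
    is cut at least twice.  Otherwise one of them contains no spoke, so its
    cycle is a whole rim and the component avoids the other one: all the spokes,
    at least four, are cut.

    The index is defined because pairwise distinct colours, which can be chosen
    greedily from lists as long as the number of edges, make every edge of a
    cubic graph rich ([list_normal_colorable_edges]). *)

(** * Edges and their neighbours in a cubic graph *)

Lemma set2_inj (T : finType) (x y z : T) : [set x; y] = [set x; z] -> y = z.
Proof.
move=> E; have: y \in [set x; z] by rewrite -E !inE eqxx orbT.
rewrite !inE => /orP[]/eqP // yx; have: z \in [set x; y] by rewrite E !inE eqxx orbT.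
by rewrite yx !inE orbb => /eqP.
Qed.

Lemma set2C (T : finType) (x y : T) : [set x; y] = [set y; x].
Proof. exact: setUC. Qed.

Lemma eq_set2 (T : finType) (x y a b : T) :
  ([set x; y] == [set a; b]) = (x == a) && (y == b) || (x == b) && (y == a).
Proof.
apply/eqP/orP=> [E | []/andP[/eqP-> /eqP->] //]; last exact: set2C.
have : x \in [set a; b] by rewrite -E set21.
rewrite !inE => /orP[]/eqP xE; subst x; rewrite eqxx /=; [left | right].
  by rewrite (set2_inj E).
by rewrite (set2C a) in E; rewrite (set2_inj E).
Qed.

Section CubicEdges.
Variable G : sgraph.

Lemma edgesP (e : {set G}) :
  reflect (exists u v, adj u v /\ e = [set u; v]) (e \in edges G).
Proof.
apply: (iffP imsetP) => [[[u v]] | [u [v [uv ->]]]].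
  by rewrite inE /= => uv ->; exists u, v.
by exists (u, v); rewrite ?inE.
Qed.

Lemma edge_in_edges (u v : G) : adj u v -> [set u; v] \in edges G.
Proof. by move=> uv; apply/edgesP; exists u, v. Qed.

Lemma edge_at (e : {set G}) u :
  e \in edges G -> u \in e -> exists2 w, adj u w & e = [set u; w].
Proof.
case/edgesP=> x [y [xy ->]]; rewrite !inE => /orP[]/eqP->; first by exists y.
by exists x; rewrite 1?adj_sym // setUC.
Qed.

Hypothesis cubicG : cubic G.

Lemma cubic_nbrs (u a b c w : G) :
  uniq [:: a; b; c] -> adj u a -> adj u b -> adj u c ->
  adj u w = (w \in [:: a; b; c]).
Proof.
move=> Uabc ua ub uc; have: [set y in [:: a; b; c]] = [set y | adj u y].
  apply/eqP; rewrite eqEcard cubicG cardsE (card_uniqP Uabc) andbT.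
  by apply/subsetP=> y; rewrite !inE => /or3P[]/eqP->.
by move/setP/(_ w); rewrite !inE.
Qed.

Lemma cubic_other_nbrs (u v : G) : adj u v ->
  exists a b, [/\ uniq [:: v; a; b], adj u a & adj u b].
Proof.
move=> uv; have /eqP/cards2P[a [b [ab E]]] : #|[set y | adj u y] :\ v| = 2.
  by have := cardsD1 v [set y | adj u y]; rewrite cubicG !inE uv => -[].
have : a \in [set y | adj u y] :\ v by rewrite E !inE eqxx.
have : b \in [set y | adj u y] :\ v by rewrite E !inE eqxx orbT.
rewrite !inE => /andP[bv ub] /andP[av ua]; exists a, b.
by split; rewrite //= !inE negb_or ab 1?eq_sym av eq_sym bv.
Qed.

Section AroundAnEdge.
Variables u v a b c d : G.
Hypotheses (uv : adj u v) (Uu : uniq [:: v; a; b]) (Uv : uniq [:: u; c; d]).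
Hypotheses (ua : adj u a) (ub : adj u b) (vc : adj v c) (vd : adj v d).

Lemma adjacent_edges_cubic :
  adjacent_edges [set u; v] =
    [set f in [:: [set u; a]; [set u; b]; [set v; c]; [set v; d]]].
Proof.
have vu : adj v u by rewrite adj_sym.
move: (Uu) (Uv); rewrite /= !inE !negb_or -!andbA !andbT.
move=> /and3P[va vb ab] /and3P[xuc ud cd].
apply/setP=> f; rewrite !inE; apply/idP/idP.
  case/and3P=> fE fuv /set0Pn[x]; rewrite !inE => /andP[xf] /orP[]/eqP xE.
    move: xf fuv; rewrite xE => /(edge_at fE)[w uw ->].
    move: uw; rewrite (cubic_nbrs w Uu uv ua ub) !inE.
    by case/or3P=> /eqP->; rewrite ?eqxx ?orbT.
  move: xf fuv; rewrite xE => /(edge_at fE)[w vw ->].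
  move: vw; rewrite (cubic_nbrs w Uv vu vc vd) !inE.
  by case/or3P=> /eqP->; rewrite ?eqxx ?orbT // setUC eqxx.
have side x y z : adj x y -> adj x z -> z != y ->
    [&& [set x; z] \in edges G, [set x; z] != [set x; y]
      & [set x; z] :&: [set x; y] != set0].
  move=> xy xz zy; rewrite edge_in_edges //=; apply/andP; split.
    by apply: contraNneq zy => /set2_inj->.
  by apply/set0Pn; exists x; rewrite !inE eqxx.
case/or4P=> /eqP->.
- by apply: (side u v a); rewrite // eq_sym.
- by apply: (side u v b); rewrite // eq_sym.
- by rewrite (setUC [set u] [set v]); apply: (side v u c); rewrite // eq_sym.
by rewrite (setUC [set u] [set v]); apply: (side v u d); rewrite // eq_sym.
Qed.

Lemma uniq_adjacent_edges :
  uniq [:: [set u; a]; [set u; b]; [set v; c]; [set v; d]].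
Proof.
move: (Uu) (Uv); rewrite /= !inE !negb_or -!andbA !andbT.
move=> /and3P[va vb ab] /and3P[xuc ud cd].
have uNv : u != v by apply: contraTneq uv => ->; rewrite adj_irrefl.
have N x y : u != y -> [set u; x] != [set v; y].
  move=> uy; apply: contraTneq (set21 u x) => ->.
  by rewrite !inE negb_or uNv.
rewrite !N //=; apply/andP.
by split; [apply: contraNneq ab | apply: contraNneq cd] => /set2_inj->.
Qed.

End AroundAnEdge.

Lemma adj_in_adjacent_edges (u a b : G) :
  adj u a -> adj u b -> a != b -> [set u; b] \in adjacent_edges [set u; a].
Proof.
move=> ua ub ab; rewrite !inE edge_in_edges //=; apply/andP; split.
  by apply: contraNneq ab => /set2_inj->.
by apply/set0Pn; exists u; rewrite !inE eqxx.
Qed.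

End CubicEdges.

(** * Forcing an edge to be rich *)

Section NormalColorings.
Variables (G : sgraph) (C : choiceType) (phi : {set G} -> C).
Hypothesis cubicG : cubic G.

Lemma proper_neq (u a b : G) : proper_edge_coloring phi ->
  adj u a -> adj u b -> a != b -> phi [set u; a] != phi [set u; b].
Proof.
move=> prop ua ub ab; apply/eqP; apply: prop; first exact: edge_in_edges.
exact: adj_in_adjacent_edges.
Qed.

Lemma adjacent_colors_cubic (u v a b c d : G) :
  adj u v -> uniq [:: v; a; b] -> uniq [:: u; c; d] ->
  adj u a -> adj u b -> adj v c -> adj v d ->
  adjacent_colors phi [set u; v] =
    [fset x in map phi [:: [set u; a]; [set u; b]; [set v; c]; [set v; d]]]%fset.
Proof.
move=> uv Uu Uv ua ub vc vd; apply/fsetP=> x.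
have E := adjacent_edges_cubic cubicG uv Uu Uv ua ub vc vd.
rewrite in_fset; apply/imfsetP/mapP => -[f /= fE ->]; exists f => //.
  by move: fE; rewrite E inE.
by rewrite /= E inE.
Qed.

(** A poor edge would have the colour of the spur [u b] at its other end; so if
    that colour is missing at [v], the edge [u v] is rich.  Only the spur has to
    be controlled, which is what makes the outer edges of the theta graph
    effective. *)
Lemma rich_neq (u v a b c : G) : normal_edge_coloring phi ->
  adj u v -> uniq [:: v; a; b] -> adj u a -> adj u b -> adj v c -> c != u ->
  (forall d, adj v d -> d != u -> phi [set u; b] != phi [set v; d]) ->
  phi [set u; a] != phi [set v; c].
Proof.
move=> [prop normal] uv Uu ua ub vc cu bP.
have [d [Uv vd]] : exists d, uniq [:: u; c; d] /\ adj v d.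
  have vu : adj v u by rewrite adj_sym.
  have [x [y [U vx vy]]] := cubic_other_nbrs cubicG vu.
  move: (vc); rewrite (cubic_nbrs cubicG c U vu vx vy) !inE (negbTE cu) /=.
  case/orP=> /eqP->; first by exists y.
  exists x; split=> //; move: U.
  by rewrite /= !inE !negb_or (eq_sym y) (andbC (u != y)).
have abN : phi [set u; a] != phi [set u; b].
  by apply: proper_neq => //; move: Uu; rewrite /= !inE => /and3P[].
have [du cd] : d != u /\ c != d.
  by move: Uv; rewrite /= !inE negb_or ![u == _]eq_sym => /and3P[/andP[_ ->] ->].
have cdN : phi [set v; c] != phi [set v; d] by apply: proper_neq.
have bc := bP c vc cu; have bd := bP d vd du.
apply: contraTneq isT => ac.
have := adjacent_colors_cubic uv Uu Uv ua ub vc vd.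
rewrite /= ac => E.
(* With a repetition among its four neighbours, [u v] sees three colours. *)
have card3 : #|` adjacent_colors phi [set u; v]| = 3.
  rewrite E; set x := phi [set v; c]; set y := phi [set u; b]; set z := phi [set v; d].
  have -> : [fset w in [:: x; y; x; z]]%fset = (y |` [fset x; z])%fset.
    by apply/fsetP=> w; rewrite !inE; do 3!case: (w == _).
  by rewrite cardfsU1 cardfs2 !inE negb_or bc bd cdN.
by have [] := normal _ (edge_in_edges uv); rewrite /rich /poor card3.
Qed.

End NormalColorings.

(** * A theta graph with too few colours *)

Section Theta.
Variables (G : sgraph) (p q u v s t u' v' s' t' : G).
Hypothesis cubicG : cubic G.
Hypothesis Utheta : uniq [:: p; q; u; v; s; t].
Hypotheses (pu : adj p u) (uq : adj u q) (pv : adj p v) (vq : adj v q).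
Hypotheses (ps : adj p s) (st : adj s t) (tq : adj t q).
Hypotheses (uu' : adj u u') (vv' : adj v v') (ss' : adj s s') (tt' : adj t t').
Hypotheses (Uu : uniq [:: p; q; u']) (Uv : uniq [:: p; q; v']).
Hypotheses (Us : uniq [:: p; t; s']) (Ut : uniq [:: q; s; t']).

Definition theta_edges : seq {set G} :=
  [:: [set p; u]; [set u; q]; [set p; v]; [set v; q];
      [set p; s]; [set s; t]; [set t; q]].

(** Of the 21 pairs of edges, ten share a vertex.  Each of the other eleven is
    joined by an edge with an outer edge as a spur at one end, and at the other
    end of this middle edge there are only edges of the theta graph, or, for the
    middle edge [s t], the edge [t q] and the outer edge [t t']. *)
Lemma theta_rainbow (C : choiceType) (phi : {set G} -> C) :
  normal_edge_coloring phi ->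
  phi [set u; u'] \notin map phi theta_edges ->
  phi [set v; v'] \notin map phi theta_edges ->
  phi [set s; s'] \notin map phi theta_edges ->
  phi [set t; t'] \notin map phi theta_edges ->
  phi [set s; s'] != phi [set t; t'] ->
  uniq (map phi theta_edges).
Proof.
move=> norm uN vN sN tN stN.
have prop := norm.1.
have up : adj u p by rewrite adj_sym.
have qu : adj q u by rewrite adj_sym.
have vp : adj v p by rewrite adj_sym.
have qv : adj q v by rewrite adj_sym.
have sp : adj s p by rewrite adj_sym.
have ts : adj t s by rewrite adj_sym.
have qt : adj q t by rewrite adj_sym.
move: (Utheta); rewrite /= !inE !negb_or -!andbA andbT.
move=> /andP[pq /andP[pu_ /andP[pv_ /andP[ps_ /andP[pt_]]]]].
move=> /andP[qu_ /andP[qv_ /andP[qs_ /andP[qt_]]]].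
move=> /andP[uv_ /andP[us_ /andP[ut_ /andP[vs_ /andP[vt_ st_]]]]].
have Up : uniq [:: u; v; s] by rewrite /= !inE !negb_or uv_ us_ vs_.
have Uq : uniq [:: u; v; t] by rewrite /= !inE !negb_or uv_ ut_ vt_.
have in_p x : adj p x -> phi [set p; x] \in map phi theta_edges.
  rewrite (cubic_nbrs cubicG x Up pu pv ps) !inE.
  by case/or3P=> /eqP->; rewrite eqxx ?orbT.
have in_q x : adj q x -> phi [set q; x] \in map phi theta_edges.
  rewrite (cubic_nbrs cubicG x Uq qu qv qt) !(set2C q) !inE.
  by case/or3P=> /eqP->; rewrite eqxx ?orbT.
have not_p c x : c \notin map phi theta_edges -> adj p x -> c != phi [set p; x].
  by move=> cN px; apply: contraNneq cN => ->; apply: in_p.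
have not_q c x : c \notin map phi theta_edges -> adj q x -> c != phi [set q; x].
  by move=> cN px; apply: contraNneq cN => ->; apply: in_q.
have swap (x y z : G) : uniq [:: x; y; z] -> uniq [:: y; x; z].
  by rewrite /= !inE !negb_or (eq_sym y x) => /and3P[/andP[-> ->] ->].
(* In [xN_y], the middle edge is [x y] and its spur is the outer edge at [x]. *)
have uN_q c : adj q c -> c != u -> phi [set u; p] != phi [set q; c].
  move=> qc cu; apply: (rich_neq cubicG norm uq (swap _ _ _ Uu)) => //.
  by move=> d qd _; apply: not_q.
have vN_q c : adj q c -> c != v -> phi [set v; p] != phi [set q; c].
  move=> qc cv; apply: (rich_neq cubicG norm vq (swap _ _ _ Uv)) => //.
  by move=> d qd _; apply: not_q.
have uN_p c : adj p c -> c != u -> phi [set u; q] != phi [set p; c].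
  move=> pc cu; apply: (rich_neq cubicG norm up Uu) => //.
  by move=> d pd _; apply: not_p.
have vN_p c : adj p c -> c != v -> phi [set v; q] != phi [set p; c].
  move=> pc cv; apply: (rich_neq cubicG norm vp Uv) => //.
  by move=> d pd _; apply: not_p.
have sN_p c : adj p c -> c != s -> phi [set s; t] != phi [set p; c].
  move=> pc cs; apply: (rich_neq cubicG norm sp Us) => //.
  by move=> d pd _; apply: not_p.
have tN_q c : adj q c -> c != t -> phi [set t; s] != phi [set q; c].
  move=> qc ct; apply: (rich_neq cubicG norm tq Ut) => //.
  by move=> d qd _; apply: not_q.
have sN_t : phi [set s; p] != phi [set t; q].
  apply: (rich_neq cubicG norm st (swap _ _ _ Us)) => //.
  move=> d; rewrite (cubic_nbrs cubicG d Ut tq ts tt') !inE.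
  by case/or3P=> /eqP-> //; rewrite ?eqxx // -(set2C q) not_q.
rewrite /= andbT.
do ![apply/andP; split].
- by rewrite (set2C p); apply: (proper_neq prop); rewrite // eq_sym.
- by apply: (proper_neq prop); rewrite // eq_sym.
- by rewrite (set2C p) (set2C v); apply: uN_q; rewrite // eq_sym.
- by apply: (proper_neq prop); rewrite // eq_sym.
- by rewrite eq_sym; apply: sN_p; rewrite // eq_sym.
- by rewrite (set2C p) (set2C t); apply: uN_q; rewrite // eq_sym.
- by apply: uN_p; rewrite // eq_sym.
- by rewrite (set2C u) (set2C v); apply: (proper_neq prop); rewrite // eq_sym.
- by apply: uN_p; rewrite // eq_sym.
- by rewrite eq_sym (set2C s) (set2C u); apply: tN_q; rewrite // eq_sym.
- by rewrite (set2C u) (set2C t); apply: (proper_neq prop); rewrite // eq_sym.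
- by rewrite (set2C p); apply: (proper_neq prop); rewrite // eq_sym.
- by apply: (proper_neq prop); rewrite // eq_sym.
- by rewrite eq_sym; apply: sN_p; rewrite // eq_sym.
- by rewrite (set2C p) (set2C t); apply: vN_q; rewrite // eq_sym.
- by apply: vN_p; rewrite // eq_sym.
- by rewrite eq_sym (set2C s) (set2C v); apply: tN_q; rewrite // eq_sym.
- by rewrite (set2C v) (set2C t); apply: (proper_neq prop); rewrite // eq_sym.
- by rewrite (set2C p); apply: (proper_neq prop); rewrite // eq_sym.
- by rewrite (set2C p); exact: sN_t.
- by rewrite (set2C s); apply: (proper_neq prop); rewrite // eq_sym.
Qed.

Definition palette (k : nat) : {fset nat} := [fset x in iota k 6]%fset.

Lemma in_palette k c : (c \in palette k) = (k <= c < k + 6).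
Proof. by rewrite in_fset; apply: mem_iota. Qed.

Lemma card_palette k : #|` palette k| = 6.
Proof. by rewrite card_fseq undup_id ?iota_uniq // size_iota. Qed.

(** The outer edges have their colours in two further palettes: those of [s s']
    and [t t'] are disjoint, since two outer edges of the same colour would allow
    [s t] to be poor. *)
Definition theta_lists (e : {set G}) : {fset nat} :=
  if e \in theta_edges then palette 0
  else if e == [set t; t'] then palette 12 else palette 6.

Lemma theta_not_6_choosable : ~ list_normal_colorable G 6.
Proof.
move=> /(_ _ theta_lists)[e _ | phi [norm phiL]].
  by rewrite /theta_lists; do 2?case: ifP => _; rewrite card_palette.
move: (Utheta) (Uu) (Uv) (Us) (Ut); rewrite /= !inE !negb_or -!andbA !andbT.
move=> /andP[/negbTE pq /andP[/negbTE pu_ /andP[/negbTE pv_]]].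
move=> /andP[/negbTE ps_ /andP[/negbTE pt_]].
move=> /andP[/negbTE qu_ /andP[/negbTE qv_ /andP[/negbTE qs_ /andP[/negbTE qt_]]]].
move=> /andP[/negbTE uv_ /andP[/negbTE us_ /andP[/negbTE ut_]]].
move=> /andP[/negbTE vs_ /andP[/negbTE vt_ /negbTE st_]].
move=> /and3P[_ /negbTE pu' /negbTE qu'] /and3P[_ /negbTE pv' /negbTE qv'].
move=> /and3P[_ /negbTE ps' /negbTE ts'] /and3P[_ /negbTE qt' /negbTE st'].
have uN : [set u; u'] \notin theta_edges.
  rewrite !inE !eq_set2 (eq_sym u p) (eq_sym u q) (eq_sym u' p) (eq_sym u' q).
  by rewrite pu_ qu_ pu' qu' uv_ us_ ut_ ?andbF.
have vN : [set v; v'] \notin theta_edges.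
  rewrite !inE !eq_set2 (eq_sym v p) (eq_sym v q) (eq_sym v u).
  by rewrite (eq_sym v' p) (eq_sym v' q) pv_ qv_ pv' qv' uv_ vs_ vt_ ?andbF.
have sN : [set s; s'] \notin theta_edges.
  rewrite !inE !eq_set2 (eq_sym s p) (eq_sym s q) (eq_sym s u) (eq_sym s v).
  by rewrite (eq_sym s' p) (eq_sym s' t) ps_ qs_ us_ vs_ st_ ps' ts' ?andbF.
have tN : [set t; t'] \notin theta_edges.
  rewrite !inE !eq_set2 (eq_sym t p) (eq_sym t q) (eq_sym t u) (eq_sym t v).
  rewrite (eq_sym t s) (eq_sym t' q) (eq_sym t' s).
  by rewrite pt_ qt_ ut_ vt_ st_ qt' st' ?andbF.
have sNt : [set s; s'] != [set t; t'] by rewrite eq_set2 st_ (eq_sym s' t) ts' andbF.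
have inner c : c \in map phi theta_edges -> c < 6.
  case/mapP=> e eT ->; have : e \in edges G.
    by move: eT; rewrite !inE; do 6?case/orP; move/eqP->; apply: edge_in_edges.
  by move/phiL; rewrite /theta_lists eT in_palette.
have outer e : e \in edges G -> e \notin theta_edges -> phi e >= 6.
  move=> /phiL; rewrite /theta_lists => + /negbTE eN; rewrite eN.
  by case: ifP => _; rewrite in_palette => /andP[+ _]; apply: leq_trans.
have outerN e : e \in edges G -> e \notin theta_edges -> phi e \notin map phi theta_edges.
  by move=> eE eN; apply/negP=> /inner; rewrite ltnNge outer.
have st_neq : phi [set s; s'] != phi [set t; t'].
  move: (phiL _ (edge_in_edges ss')) (phiL _ (edge_in_edges tt')).
  rewrite /theta_lists (negbTE sN) (negbTE tN) (negbTE sNt) eqxx !in_palette.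
  by move=> /andP[_ lt12] /andP[ge12 _]; apply: contraTneq ge12 => <-; rewrite -ltnNge.
have U : uniq (map phi theta_edges).
  by apply: theta_rainbow => //; apply: outerN => //; apply: edge_in_edges.
have /(uniq_leq_size U) : {subset map phi theta_edges <= iota 0 6}.
  by move=> c /inner; rewrite mem_iota.
by rewrite size_map size_iota.
Qed.

End Theta.

(** * The list normal chromatic index of a cubic graph exists *)

Lemma distinct_choice (T : eqType) (C : choiceType) (c0 : C) (L : T -> {fset C})
    (r : seq T) :
  uniq r -> (forall x, x \in r -> size r <= #|` L x|) ->
  exists2 f : T -> C, {in r &, injective f} & forall x, x \in r -> f x \in L x.
Proof.
elim: r => [_ _ | x r IH /= /andP[xr Ur] sizeL]; first by exists (fun=> c0).
have [y ry | f f_inj fL] := IH Ur.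
  by apply: ltnW; apply: sizeL; rewrite inE ry orbT.
have [c cLx c_new] : exists2 c, c \in L x & c \notin map f r.
  have /fsubsetPn[c cLx] : ~~ (L x `<=` [fset c in map f r])%fset.
    apply/negP=> /fsubset_leq_card; rewrite card_fseq leqNgt => /negP[].
    apply: leq_ltn_trans (size_undup _) _; rewrite size_map.
    by apply: sizeL; rewrite inE eqxx.
  by rewrite in_fset => cN; exists c.
exists (fun y => if y == x then c else f y) => [y z | y].
  have new w : w \in r -> c <> f w by move=> wr cE; rewrite cE map_f in c_new.
  rewrite !inE; case: eqP => [-> | _] /=; case: eqP => [-> | _] //= yr zr.
  - by move/(new _ zr).
  - by move/esym/(new _ yr).
  exact: f_inj.
by rewrite inE; case: eqP => [-> | _] //= yr; apply: fL.
Qed.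

(** An injective colouring is normal on a cubic graph: the four neighbours of an
    edge are distinct edges, so every edge is rich.  The graph has to be
    nonempty: with no vertex, a colouring from an empty set of colours would
    still have to give a value to the empty set of vertices. *)
Lemma list_normal_colorable_edges (G : sgraph) :
  cubic G -> 0 < #|G| -> list_normal_colorable G #|edges G|.
Proof.
move=> cubicG /card_gt0P[x0 _] C L sizeL.
have [e0 e0E] : exists e, e \in edges G.
  have /card_gt0P[y] : 0 < #|[set y | adj x0 y]| by rewrite cubicG.
  by rewrite inE => /edge_in_edges; exists [set x0; y].
have /fset0Pn[c0 _] : L e0 != fset0; first rewrite -cardfs_gt0.
  by apply: leq_trans (sizeL _ e0E); apply/card_gt0P; exists e0.
have [e | phi phi_inj phiL] := @distinct_choice _ _ c0 L _ (enum_uniq (edges G)).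
  by rewrite mem_enum -cardE; apply: sizeL.
exists phi; split; last by move=> e eE; apply: phiL; rewrite mem_enum.
have inj e f : e \in edges G -> f \in edges G -> phi e = phi f -> e = f.
  by move=> eE fE; apply: phi_inj; rewrite mem_enum.
split=> [e f eE | e eE].
  by rewrite !inE => /andP[fE /andP[fe _]] /(inj _ _ eE fE) ef; rewrite ef eqxx in fe.
have [u [v [uv eE']]] := edgesP _ eE; left.
have vu : adj v u by rewrite adj_sym.
have [a [b [Uu ua ub]]] := cubic_other_nbrs cubicG uv.
have [c [d [Uv vc vd]]] := cubic_other_nbrs cubicG vu.
rewrite /rich eE' (adjacent_colors_cubic _ cubicG uv Uu Uv) //.
set r := [:: [set u; a]; [set u; b]; [set v; c]; [set v; d]].
have rE : {subset r <= edges G}.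
  by move=> f; rewrite !inE; case/or4P=> /eqP->; apply: edge_in_edges.
rewrite card_fseq undup_id // map_inj_in_uniq.
  exact: uniq_adjacent_edges.
by move=> f g /rE fE /rE gE; apply: inj.
Qed.

Lemma ex_least (P : nat -> Prop) : (exists n, P n) ->
  exists2 k, P k & forall j, P j -> k <= j.
Proof.
move=> [n]; elim/ltn_ind: n => n IH Pn.
case: (classic (exists2 j, j < n & P j)) => [[j jn Pj] | noj]; first exact: IH jn Pj.
exists n => // j Pj; rewrite leqNgt; apply/negP=> jn; apply: noj.
by exists j.
Qed.

Lemma index_ge_7 (G : sgraph) : cubic G -> 0 < #|G| ->
  ~ list_normal_colorable G 6 ->
  exists2 k, list_normal_chromatic_index G k & 7 <= k.
Proof.
move=> cubicG G0 not6.
have [|k colk mink] := @ex_least (list_normal_colorable G).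
  by exists #|edges G|; apply: list_normal_colorable_edges.
exists k; first by split.
rewrite leqNgt; apply/negP=> k6; apply: not6 => C L L6; apply: colk => e eE.
exact: leq_trans (k6 : k <= 6) (L6 e eE).
Qed.

(** * Components and cycles *)

Lemma component_boundary (G : sgraph) (S : {set {set G}}) (A : {set del_edges S})
    (x y : G) :
  A \in components (del_edges S) -> x \in A -> y \notin A -> adj x y ->
  [set x; y] \in S.
Proof.
case/imsetP=> w _ ->; rewrite !inE => wx wy xy; apply: contraNT wy => xyS.
by apply: connect_trans wx (connect1 _); rewrite /= /del_adj xy.
Qed.

Lemma component_disjoint (G : sgraph) (A B : {set G}) x :
  A \in components G -> B \in components G -> A != B -> x \in A -> x \notin B.
Proof.
case/imsetP=> a _ -> /imsetP[b _ ->] AB; rewrite !inE => ax.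
apply: contraNN AB => bx; apply/eqP/setP=> y; rewrite !inE.
have symC := sym_connect_sym (@adj_sym G).
by rewrite (same_connect symC ax) (same_connect symC bx).
Qed.

(** The only property of cycles that matters below: being a set of vertices in
    which every vertex has two distinct neighbours. *)
Lemma cycle_two_nbrs (T : eqType) (e : rel T) c x :
  symmetric e -> 2 < size c -> uniq c -> cycle e c -> x \in c ->
  exists y z, [/\ y \in c, z \in c, y != z, e x y & e x z].
Proof.
move=> esym size_c Uc cyc /rot_to[i c' rot_c].
have mem_c : c =i x :: c' by move=> w; rewrite -rot_c mem_rot.
move: size_c Uc cyc; rewrite -(size_rot i) -(rot_uniq i) -(rot_cycle i) rot_c.
case: c' {rot_c} mem_c => [|y [|z c']] // mem_c _ /= /and3P[_ yN _].
case/and3P=> xy yz; rewrite rcons_path => /andP[_ zx].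
exists y, (last z c'); split=> //.
- by rewrite mem_c !inE eqxx orbT.
- by rewrite mem_c in_cons [_ \in y :: _]in_cons mem_last !orbT.
- by apply: contraNneq yN => ->; apply: mem_last.
by rewrite esym.
Qed.

(** * Two rims joined by spokes *)

Section Rims.
Variable m : nat.
Local Notation I := 'I_m.+4.

Lemma ordSS_neq (i : I) : ordS (ordS i) != i.
Proof.
apply/eqP=> /(congr1 val) /=; rewrite -addn1 modnDml addn1.
case: i => i /= lt_i; have [lt_i2 | ge_i2] := ltnP i.+2 m.+4.
  by rewrite modn_small //; lia.
by rewrite -(subnK ge_i2) modnDr modn_small; lia.
Qed.

Lemma ordS_neq (i : I) : ordS i != i.
Proof. by apply: contra (ordSS_neq i) => /eqP iS; rewrite !iS. Qed.

Lemma ordS_orbit (P : I -> Prop) i :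
  P i -> (forall j, P j -> P (ordS j)) -> forall j, P j.
Proof.
move=> Pi PS j; have val_iter k : val (iter k (@ordS _) i) = (i + k) %% m.+4.
  elim: k => [|k /= ->]; first by rewrite addn0 modn_small.
  by rewrite -addn1 modnDml addn1 addnS.
have -> : j = iter (j + (m.+4 - i)) (@ordS _) i.
  apply: val_inj; rewrite val_iter addnCA subnKC 1?ltnW //.
  by rewrite modnDr modn_small.
by elim: (_ + _) => //= k; apply: PS.
Qed.

Lemma rim_exit (P : pred I) i j : P i -> ~~ P j -> exists k, P k && ~~ P (ordS k).
Proof.
move=> Pi nPj; apply/existsP; apply: contraR nPj => /existsPn noexit.
by apply: (@ordS_orbit (fun k => P k) i) => // k Pk; have := noexit k; rewrite Pk negbK.
Qed.

Variables (s : I -> I) (sK : involutive s).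

(** The vertices of the two rims are [(false, i)] and [(true, i)].  One map [s]
    serves as the matching in both directions, hence it is an involution.  The
    length [m + 4] of the rims excludes loops and double edges, and it makes the
    number of spokes exceed the size of the cuts to be excluded. *)
Definition rims_rel (x y : bool * I) : bool :=
  if x.1 == y.1 then (y.2 == ordS x.2) || (x.2 == ordS y.2) else y.2 == s x.2.

Lemma rims_sym : symmetric rims_rel.
Proof.
move=> x y; rewrite /rims_rel eq_sym orbC; case: ifP => // _.
by rewrite eq_sym (can2_eq sK sK).
Qed.

Lemma rims_irrefl : irreflexive rims_rel.
Proof. by move=> x; rewrite /rims_rel eqxx orbb eq_sym (negbTE (ordS_neq _)). Qed.

Definition rims : sgraph := SGraph rims_sym rims_irrefl.

Definition spoke_end (x : rims) : rims := (~~ x.1, s x.2).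

Lemma adj_rim b i : @adj rims (b, i) (b, ordS i).
Proof. by rewrite /= /rims_rel !eqxx. Qed.

Lemma adj_spoke (x : rims) : adj x (spoke_end x).
Proof. by rewrite /= /rims_rel /= eqxx; case: x.1. Qed.

Lemma rims_nbrs b i (y : rims) : adj ((b, i) : rims) y ->
  y \in [:: (b, ordS i); (b, ord_pred i); spoke_end (b, i)].
Proof.
case: y => c j; rewrite /= /rims_rel /spoke_end !inE !xpair_eqE /=.
case: eqP => [<- | bc].
  rewrite eqxx; case/orP=> /eqP->; first by rewrite eqxx.
  by rewrite ordSK eqxx orbT.
by move=> ->; rewrite andbT; case: b c bc => -[].
Qed.

Lemma cubic_rims : cubic rims.
Proof.
case=> b i; transitivity #|[:: (b, ordS i); (b, ord_pred i); spoke_end (b, i)]|.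
  apply: eq_card => y; rewrite inE; apply/idP/idP => [/rims_nbrs // |].
  rewrite !inE => /or3P[]/eqP->; [exact: adj_rim | | exact: adj_spoke].
  by rewrite adj_sym -{2}(ord_predK i) adj_rim.
have neq : ordS i != ord_pred i.
  by have := ordSS_neq (ord_pred i); rewrite ord_predK.
by apply/card_uniqP; rewrite /= !inE !xpair_eqE eqxx (negbTE neq); case: b.
Qed.

Lemma connected_rims : connected rims.
Proof.
split=> [|x y]; first by apply/card_gt0P; exists (false, ord0).
have rim b i j : connect (@adj rims) (b, i) (b, j).
  move: j; apply: (@ordS_orbit _ i) => // j ij.
  by apply: connect_trans ij (connect1 (adj_rim b j)).
have [xy | xy] := eqVneq x.1 y.1.
  by case: x y xy => b i [c j] /= ->.
apply: connect_trans (connect1 (adj_spoke x)) _.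
by case: x y xy => -[] i [[] j] //= _; apply: rim.
Qed.

Definition rim_edge (x : rims) : {set rims} := [set x; (x.1, ordS x.2)].

Lemma rim_edge_inj : injective rim_edge.
Proof.
move=> [b i] [c j] /eqP; rewrite eq_set2 !xpair_eqE /=.
case/orP=> /andP[/andP[/eqP bc /eqP ij]]; first by rewrite bc ij.
by case/andP=> _ /eqP; rewrite ij => /eqP; rewrite (negbTE (ordSS_neq _)).
Qed.

(** A vertex of a cycle that avoids its spoke has both of its rim neighbours on
    the cycle, and so the cycle runs along the whole rim. *)
Lemma cycle_in_rims (c : seq rims) :
  2 < size c -> uniq c -> cycle (@adj rims) c ->
  (exists2 x, x \in c & spoke_end x \in c) \/ exists b, forall i, (b, i) \in c.
Proof.
move=> size_c Uc cyc.
case: (boolP (has (fun x => spoke_end x \in c) c)) => [/hasP | /hasPn nospoke].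
  by left.
right; have [[b i] bi] : exists x, x \in c.
  by case: (c) size_c => // x ? _; exists x; rewrite inE eqxx.
exists b; apply: (@ordS_orbit (fun j => (b, j) \in c) i) => // j bj.
have [y [z [yc zc]]] := cycle_two_nbrs (@adj_sym rims) size_c Uc cyc bj.
move=> yz /rims_nbrs yE /rims_nbrs zE.
have side w : w \in c -> w \in [:: (b, ordS j); (b, ord_pred j); spoke_end (b, j)] ->
    w != (b, ordS j) -> w = (b, ord_pred j).
  move=> wc; rewrite !inE => /or3P[/eqP-> /eqP // | /eqP // | /eqP wE].
  by have := nospoke _ bj; rewrite -wE wc.
have [yS | yS] := eqVneq y (b, ordS j); first by rewrite -yS.
have [zS | zS] := eqVneq z (b, ordS j); first by rewrite -zS.
by rewrite (side y) // (side z) // eqxx in yz.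
Qed.

Section Cut.
Variables (S : {set {set rims}}) (A : {set del_edges S}).
Hypothesis compA : A \in components (del_edges S).

(** A tour of a rim that lies only partly in a component leaves the component and
    comes back to it, by different edges. *)
Lemma rim_cut b i j : (b, i) \in A -> (b, j) \notin A ->
  exists k l, [/\ k != l, rim_edge (b, k) \in S & rim_edge (b, l) \in S].
Proof.
move=> biA bjA.
have [k /andP[kA kSA]] := @rim_exit (fun k => (b, k) \in A) i j biA bjA.
have [|l /andP[lA lSA]] := @rim_exit (fun k => (b, k) \notin A) j i bjA.
  by rewrite negbK.
exists k, l; split; first by apply: contraNneq lA => <-.
  exact: component_boundary compA kA kSA (adj_rim b k).
rewrite /rim_edge set2C; rewrite negbK in lSA.
by apply: component_boundary compA lSA lA _; rewrite adj_sym; apply: adj_rim.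
Qed.

Lemma spokes_cut b : (forall i, (b, i) \in A) ->
  (forall i, spoke_end (b, i) \notin A) -> 4 <= #|S|.
Proof.
move=> bA bNA; pose f i : {set rims} := [set (b, i); spoke_end (b, i)].
have f_inj : injective f.
  move=> i j /eqP; rewrite eq_set2 /spoke_end !xpair_eqE /= eqxx.
  by case/orP=> [/andP[/eqP] // | ]; case: (b).
apply: leq_trans (_ : #|f @: [set: I]| <= _).
  by rewrite card_imset // cardsT card_ord.
apply/subset_leq_card/subsetP=> _ /imsetP[i _ ->].
exact: component_boundary compA (bA i) (bNA i) (adj_spoke _).
Qed.

Lemma full_spokes_cut (x y : rims) : x \in A -> spoke_end x \in A ->
  y \notin A -> spoke_end y \notin A -> 4 <= #|S|.
Proof.
move=> xA xA' yA yA'.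
have meets b : exists i, (b, i) \in A.
  case: (x) xA xA' => c i cA cA'; have [-> | bc] := eqVneq b c; first by exists i.
  by exists (s i); have -> : b = ~~ c by case: b c bc {cA cA'} => -[].
have misses b : exists j, (b, j) \notin A.
  case: (y) yA yA' => c i cA cA'; have [-> | bc] := eqVneq b c; first by exists i.
  by exists (s i); have -> : b = ~~ c by case: b c bc {cA cA'} => -[].
have cut b : exists k l, [/\ k != l, rim_edge (b, k) \in S & rim_edge (b, l) \in S].
  by have [[i iA] [j jA]] := (meets b, misses b); apply: rim_cut iA jA.
have [k0 [l0 [kl0 k0S l0S]]] := cut false.
have [k1 [l1 [kl1 k1S l1S]]] := cut true.
pose r := [:: (false, k0); (false, l0); (true, k1); (true, l1)].
have Ur : uniq (map rim_edge r).
  by rewrite (map_inj_uniq rim_edge_inj) /= !inE !xpair_eqE /= !orbF kl0 kl1.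
rewrite cardE; apply: (uniq_leq_size Ur) => e.
by rewrite mem_enum !inE => /or4P[]/eqP->.
Qed.

End Cut.

Lemma cyclically_4_edge_connected_rims : cyclically_4_edge_connected rims.
Proof.
split; first exact: connected_rims.
case=> S [_ S4 [A [B [compA compB AB cycA cycB]]]]; move: S4; apply/negP; rewrite -leqNgt.
have full (D : {set del_edges S}) : D \in components (del_edges S) ->
    contains_cycle D ->
    4 <= #|S| \/ exists2 x : rims, x \in D & spoke_end x \in D.
  move=> compD [c [size_c Uc cyc cD]].
  have cyc' : cycle (@adj rims) c.
    by apply: sub_cycle cyc => x y /andP[].
  have [[x xc xc'] | [b bc]] := cycle_in_rims size_c Uc cyc'.
    by right; exists x; apply: cD.
  case: (boolP [exists i, spoke_end (b, i) \in D]) => [/existsP[i iD] | /existsPn nD].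
    by right; exists (b, i) => //; apply: cD.
  by left; apply: (spokes_cut compD (b := b)) => // i; apply: cD.
have [//|[x xA xA']] := full A compA cycA.
have [//|[y yB yB']] := full B compB cycB.
have BA : B != A by rewrite eq_sym.
by apply: (full_spokes_cut compA xA xA' (y := y)); apply: component_disjoint BA _.
Qed.

End Rims.

(** * The family: prisms with two consecutive spokes crossed *)

Section CrossedPrism.
Variable m : nat.

Local Notation c0 := (@Ordinal m.+4 0 isT).
Local Notation c1 := (@Ordinal m.+4 1 isT).
Local Notation c2 := (@Ordinal m.+4 2 isT).
Local Notation c3 := (@Ordinal m.+4 3 isT).

Definition crossed_prism : sgraph := rims (tpermK c0 c1).

(** The crossing turns columns 0 and 1 into a 4-cycle in which the two vertices
    of column 1 are opposite.  They are the branch vertices [p] and [q], column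
    0 provides [u] and [v], and the third path runs through column 2. *)
Lemma crossed_prism_not_6_choosable : ~ list_normal_colorable crossed_prism 6.
Proof.
have S01 : ordS c0 = c1 by apply: val_inj; rewrite /= modn_small.
have S12 : ordS c1 = c2 by apply: val_inj; rewrite /= modn_small.
have S23 : ordS c2 = c3 by apply: val_inj; rewrite /= modn_small.
have adj01 b : @adj crossed_prism (b, c0) (b, c1) by rewrite -S01; apply: adj_rim.
have adj12 b : @adj crossed_prism (b, c1) (b, c2) by rewrite -S12; apply: adj_rim.
have adj23 b : @adj crossed_prism (b, c2) (b, c3) by rewrite -S23; apply: adj_rim.
have adjp0 b : @adj crossed_prism (b, c0) (b, ord_pred c0).
  by rewrite adj_sym -{2}(ord_predK c0); apply: adj_rim.
have cross b : @adj crossed_prism (b, c0) (~~ b, c1).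
  by rewrite -[c1](tpermL c0 c1); apply: adj_spoke.
have straight b : @adj crossed_prism (b, c2) (~~ b, c2).
  by have := adj_spoke ((b, c2) : crossed_prism); rewrite /spoke_end /= tpermD.
(* Closing the rims does not bring the outer edges at [u], [v] back to [p], [q]. *)
have pred0 : c1 != ord_pred c0.
  by rewrite -(inj_eq (@ordS_inj _)) ord_predK S12.
apply: (@theta_not_6_choosable crossed_prism (false, c1) (true, c1) (false, c0)
  (true, c0) (false, c2) (true, c2) (false, ord_pred c0) (true, ord_pred c0)
  (false, c3) (true, c3)) => //; try by [exact: cubic_rims | rewrite adj_sym].
all: by rewrite /= !inE !xpair_eqE ?(negbTE pred0).
Qed.

Lemma card_crossed_prism : #|crossed_prism| = m.+4.*2.
Proof. by rewrite card_prod card_bool card_ord mul2n. Qed.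

End CrossedPrism.

Theorem theorem5p3 :
  exists G : nat -> sgraph,
    (forall i j : nat, i <> j -> ~ isomorphic (G i) (G j)) /\
    (forall i : nat,
       [/\ cubic (G i),
           cyclically_4_edge_connected (G i) &
           exists2 k : nat, list_normal_chromatic_index (G i) k & 7 <= k]).
Proof.
exists crossed_prism; split=> [i j ij [f f_bij _] | i].
  apply: ij; have := bij_eq_card f_bij.
  by rewrite !card_crossed_prism => /double_inj[].
split; [exact: cubic_rims | exact: cyclically_4_edge_connected_rims |].
apply: index_ge_7; first exact: cubic_rims.
  by rewrite card_crossed_prism.
exact: crossed_prism_not_6_choosable.
Qed.
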